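(* Let $X$ be a second countable Baire complex topological vector space and let $\Gamma\subset\mathcal{B}(X)$. The following assertions are equivalent: (i) $\mathbb{D}C(\Gamma)$ is dense in $X$; (ii) $\Gamma$ is disk transitive. In this case, $\Gamma$ is diskcyclic and the set $\mathbb{D}C(\Gamma)$ of all diskcyclic vectors of $\Gamma$ is a dense $G_\delta$ set.
   Context: $\mathcal{B}(X)$ is the set of all continuous linear operators on $X$, and $\mathbb{D}=\{\alpha\in\mathbb{C}:|\alpha|\le 1\}$. A vector $x\in X$ is a diskcyclic vector for $\Gamma$ if $\{\alpha Tx:\alpha\in\mathbb{D},\,T\in\Gamma\}$ is dense in $X$; $\mathbb{D}C(\Gamma)$ is the set of all diskcyclic vectors for $\Gamma$, and $\Gamma$ is diskcyclic if $\mathbb{D}C(\Gamma)\ne\emptyset$. $\Gamma$ is disk transitive if for any pair $(U,V)$ of nonempty open subsets of $X$ there exist $\alpha\in\mathbb{D}\setminus\{0\}$ and $T\in\Gamma$ such that $T(\alpha U)\cap V\neq\emptyset$. *)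

(* Defs.v *)
From mathcomp Require Import all_boot all_order all_algebra.
From mathcomp Require Import complex.
From mathcomp Require Import boolp classical_sets functions cardinality reals.
From mathcomp Require Import topology tvs borel_hierarchy.

Set Implicit Arguments.
Unset Strict Implicit.
Unset Printing Implicit Defensive.

Import Order.TTheory GRing.Theory Num.Theory.

Local Open Scope classical_set_scope.
Local Open Scope complex_scope.
Local Open Scope ring_scope.

Definition baire_space (T : topologicalType) : Prop :=
  forall F : nat -> set T,
    (forall i, open (F i) /\ dense (F i)) -> dense (\bigcap_i F i).

(* The closed unit disk: on R[i] the order is the partial one with
   x <= y iff y - x is a nonnegative real. *)
Definition disk (R : realType) : set R[i] := [set a | `|a| <= 1].
Arguments disk : clear implicits.

(* X need be neither locally convex nor Hausdorff. *)
Definition continuous_operators (R : realType) (X : topologicalLmodType R[i]) :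
    set {linear X -> X} :=
  [set T | continuous T].

Section diskcyclicity.
Context (R : realType) (X : topologicalLmodType R[i]).
Implicit Types (Gamma : set {linear X -> X}) (x : X).

Definition disk_orbit Gamma x : set X :=
  [set y | exists2 a, disk R a & exists2 T, Gamma T & y = a *: T x].

Definition diskcyclic_vectors Gamma : set X :=
  [set x | dense (disk_orbit Gamma x)].

Definition diskcyclic Gamma : Prop := diskcyclic_vectors Gamma !=set0.

Definition disk_transitive Gamma : Prop :=
  forall U V : set X, open U -> U !=set0 -> open V -> V !=set0 ->
    exists2 a, (disk R `\ 0) a &
      exists2 T, Gamma T & T @` [set a *: u | u in U] `&` V !=set0.

End diskcyclicity.

Arguments continuous_operators {R} X.

(* Main.v *)
Require Import Defs.
From mathcomp Require Import all_boot all_order all_algebra.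
From mathcomp Require Import complex.
From mathcomp Require Import boolp classical_sets functions cardinality reals.
From mathcomp Require Import topology tvs borel_hierarchy.

(** Birkhoff's transitivity argument.  For an open set [V], the set of vectors
    whose disk orbit meets [V] is open, and it is dense when [Gamma] is disk
    transitive.  The diskcyclic vectors are the intersection of these sets over
    a countable family of nonempty open sets refining every nonempty open set,
    so Baire's property applies.  Conversely, a diskcyclic vector in [U] has
    some [a *: T x] in [V]; if [a = 0], then [V] contains [0], hence also
    [b *: T x] for all small [b != 0]. *)

Import Order.TTheory GRing.Theory Num.Theory.

Local Open Scope classical_set_scope.
Local Open Scope complex_scope.
Local Open Scope ring_scope.

(** Discarding the empty set from a countable base leaves a countable family that still refines
    every nonempty open set. *)
Lemma countable_pi_base (T : topologicalType) (x0 : T) :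
  @second_countable T ->
  exists V : nat -> set T, (forall n, open (V n) /\ V n !=set0) /\
    forall O, open O -> O !=set0 -> exists n, V n `<=` O.
Proof.
move=> [B cB [Bopen Bnbhs]].
have cB' : countable (B `\ set0).
  by apply: sub_countable cB; apply: subset_card_le => U [].
have sub_base O : open O -> O !=set0 -> exists2 U, (B `\ set0) U & U `<=` O.
  move=> Oopen [x Ox].
  have [U [BU Ux] UO] := Bnbhs x O (open_nbhs_nbhs (conj Oopen Ox)).
  by exists U => //; split=> // /= U0; rewrite U0 in Ux.
(* Either the family is empty, which [x0] rules out because [setT] must contain a member, or [nat]
   maps onto it. *)
have [B0|[V]] := pfcard_geP cB'.
  have [U] := sub_base setT openT (ex_intro _ x0 I).
  by rewrite B0.
exists V; split=> [n|O Oopen O0].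
  have [BV /eqP/set0P V0] : (B `\ set0) (V n) by apply: funS.
  by split=> //; exact: Bopen.
have [U BU UO] := sub_base O Oopen O0.
have [n _ VnU] : (V @` setT) U by apply: (@surj _ _ _ _ V).
by exists n; rewrite VnU.
Qed.

Lemma continuous_scale_left (K : numDomainType) (X : topologicalLmodType K)
    (x : X) : continuous (fun a : K^o => a *: x).
Proof.
move=> a; apply: (@cvg_comp2 _ _ _ _ (nbhs a) (nbhs a) (nbhs x) _ _ _ _
  id (fun=> x) (fun (b : K^o) y => b *: y)).
- exact: cvg_id.
- exact: cvg_cst.
- exact: (@scale_continuous K X (a, x)).
Qed.

Lemma continuous_scale_right (K : numDomainType) (X : topologicalLmodType K)
    (a : K) : continuous (fun x : X => a *: x).
Proof.
move=> x; apply: (@cvg_comp2 _ _ _ _ (nbhs x) (nbhs (a : K^o)) (nbhs x) _ _ _ _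
  (fun=> a : K^o) id (fun (b : K^o) y => b *: y)).
- exact: cvg_cst.
- exact: cvg_id.
- exact: (@scale_continuous K X (a, x)).
Qed.

(** Since [0 = 0 *: x], continuity of scaling in the scalar pulls [V] back to a neighbourhood of the
    scalar [0], which contains a ball of some radius [e]. *)
Lemma nbhs0_small_scale (K : numFieldType) (X : topologicalLmodType K)
    (x : X) (V : set X) :
  nbhs (0 : X) V -> exists2 a : K, `|a| <= 1 /\ a != 0 & V (a *: x).
Proof.
rewrite -(scale0r x) => /(continuous_scale_left _ _ x).
move=> [e /= e0 eV].
have e1 : 0 < 1 + e by rewrite addr_gt0.
(* This scalar is positive and below both [1] and [e], so one formula meets the disk bound and the
   ball condition. *)
have a0 : 0 < e / (1 + e) by rewrite divr_gt0.
exists (e / (1 + e)).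
  by rewrite gt_eqF// gtr0_norm// ler_pdivrMr// mul1r lerDr ler01.
apply: eV => /=; rewrite sub0r normrN gtr0_norm// ltr_pdivrMr//.
by rewrite mulrDr mulr1 ltrDl mulr_gt0.
Qed.

Section diskcyclicity.
Context (R : realType) (X : topologicalLmodType R[i]).
Implicit Types (Gamma : set {linear X -> X}) (V : set X).

(** Written as a union of preimages of [V] under the maps [a *: T], so that openness reduces to
    their continuity. *)
Definition disk_hitting Gamma V : set X :=
  \bigcup_(a in disk R) \bigcup_(T in Gamma) [set x | V (a *: T x)].

Lemma disk_hittingP Gamma V x :
  disk_hitting Gamma V x <-> V `&` disk_orbit Gamma x !=set0.
Proof.
split=> [[a Da [T GT /= Vx]]|[y [Vy [a Da [T GT yE]]]]]; last first.
  by exists a => //; exists T => //=; rewrite -yE.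
by exists (a *: T x); split=> //; exists a => //; exists T.
Qed.

Lemma open_disk_hitting Gamma V :
  Gamma `<=` continuous_operators X -> open V -> open (disk_hitting Gamma V).
Proof.
move=> Gcont Vopen; apply: bigcup_open => a _; apply: bigcup_open => T GT.
apply: (open_comp (f := fun x => a *: T x)) => // x _.
apply: (continuous_comp (g := fun y => a *: y)); first exact: Gcont.
exact: continuous_scale_right.
Qed.

(** Transitivity for [(U, V)] gives [u] in [U] with [T (a *: u)] in [V]; by linearity this point is
    [a *: T u], in the disk orbit of [u]. *)
Lemma dense_disk_hitting Gamma V : disk_transitive Gamma ->
  open V -> V !=set0 -> dense (disk_hitting Gamma V).
Proof.
move=> Gtrans Vopen V0 U U0 Uopen.
have [a [Da _] [T GT [_ [[_ [u Uu <-] <-] Vy]]]] :=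
  Gtrans U V Uopen U0 Vopen V0.
by exists u; split=> //; exists a => //; exists T => //=; rewrite -linearZ.
Qed.

Lemma diskcyclic_vectors_bigcap Gamma (V : nat -> set X) :
    (forall n, open (V n) /\ V n !=set0) ->
    (forall O, open O -> O !=set0 -> exists n, V n `<=` O) ->
  diskcyclic_vectors Gamma = \bigcap_n disk_hitting Gamma (V n).
Proof.
move=> Vopen Vbase; apply/seteqP; split=> [x xcyc n _|x xhit O O0 Oopen].
  by apply/disk_hittingP; have [] := Vopen n => ? ?; exact: xcyc.
have [n VO] := Vbase O Oopen O0.
have /disk_hittingP[y [Vy xy]] := xhit n I.
by exists y; split=> //; exact: VO.
Qed.

Lemma dense_disk_transitive Gamma :
  dense (diskcyclic_vectors Gamma) -> disk_transitive Gamma.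
Proof.
move=> Ddense U V Uopen U0 Vopen V0.
have [x [Ux xcyc]] := Ddense U U0 Uopen.
have [y [Vy [a Da [T GT yE]]]] := xcyc V V0 Vopen.
(* The orbit admits the scalar [0] but transitivity does not, so [a] may have to be replaced. *)
have [b Db Vb] : exists2 b, (disk R `\ 0) b & V (b *: T x).
  have [a0|a0] := eqVneq a 0; last first.
    by exists a; [split=> //; exact/eqP | rewrite -yE].
  have V00 : nbhs (0 : X) V.
    by apply: open_nbhs_nbhs; split=> //; rewrite -(scale0r (T x)) -a0 -yE.
  have [b [b1 b0] Vb] := nbhs0_small_scale _ _ (T x) V V00.
  by exists b => //; split=> //; exact/eqP.
exists b => //; exists T => //; exists (b *: T x); split=> //.
by exists (b *: x); [exists x | rewrite linearZ].
Qed.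

End diskcyclicity.

Arguments disk_hitting {R X} Gamma V.

Theorem theorem3p6 (R : realType) (X : topologicalLmodType R[i])
    (X_second_countable : @second_countable X) (X_baire : baire_space X)
    (Gamma : set {linear X -> X})
    (Gamma_continuous : Gamma `<=` continuous_operators X) :
  (dense (diskcyclic_vectors Gamma) <-> disk_transitive Gamma) /\
  (disk_transitive Gamma ->
    [/\ diskcyclic Gamma,
        dense (diskcyclic_vectors Gamma) &
        Gdelta (diskcyclic_vectors Gamma)]).
Proof.
have [V [Vopen Vbase]] := countable_pi_base X 0 X_second_countable.
have cycE := diskcyclic_vectors_bigcap _ _ Gamma V Vopen Vbase.
have hopen n : open (disk_hitting Gamma (V n)).
  by apply: open_disk_hitting => //; have [] := Vopen n.
have Ddense : disk_transitive Gamma -> dense (diskcyclic_vectors Gamma).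
  move=> Gtrans; rewrite cycE; apply: X_baire => n; split=> //.
  by have [] := Vopen n; exact: dense_disk_hitting.
split; first by split=> //; exact: dense_disk_transitive.
move=> /Ddense Dd; split=> //; last first.
  by exists (fun n => disk_hitting Gamma (V n)).
(* The space contains [0], so a dense subset has a point. *)
have [x [_ Dx]] := Dd setT (ex_intro _ 0 I) openT.
by exists x.
Qed.
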